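(* Let $\kappa$ be an infinite cardinal, and let $\mathcal{L}\subseteq\mathrm{Scat}_\kappa$ be nonempty and downward $\preceq$-closed and such that $\trianglelefteq^{\mathcal{L}}_\kappa$ is transitive. Then $(\mathrm{LO}_\kappa,\trianglelefteq^{\mathcal{L}}_\kappa)$ has the fractal property with respect to its upper cones, that is, for every $L_0\in\mathrm{LO}_\kappa$, $(\mathrm{LO}_\kappa,\trianglelefteq^{\mathcal{L}}_\kappa)$ embeds into $(L_0{\uparrow^{\mathcal{L}}},\trianglelefteq^{\mathcal{L}}_\kappa)$, where $L_0{\uparrow^{\mathcal{L}}}=\{L\in\mathrm{LO}_\kappa: L_0\trianglelefteq^{\mathcal{L}}_\kappa L\}$.
   Context: Linear orders are reflexive and nonempty; $L\preceq L'$ means there is an embedding $f:L\to L'$, i.e. $x\le_L y\iff f(x)\le_{L'}f(y)$. For a cardinal $\kappa$, $\mathrm{LO}_\kappa$ is the set of (codes for) linear orders with domain $\kappa$, $\mathrm{Lin}_\kappa=\bigcup_{0<\lambda\le\kappa}\mathrm{LO}_\lambda$ ($\lambda$ ranging over cardinals), i.e. the nonempty linear orders of size at most $\kappa$, and $\mathrm{Scat}_\kappa\subseteq\mathrm{Lin}_\kappa$ consists of the scattered ones (those $L$ with $\mathbb{Q}\not\preceq L$). $\mathcal{L}\subseteq\mathrm{Lin}_\kappa$ is downward $\preceq$-closed if $K\in\mathrm{Lin}_\kappa$, $K\preceq L\in\mathcal{L}$ imply $K\in\mathcal{L}$; membership is meant up to isomorphism. A subset $I$ of $L$ is convex if $x\le_L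 y\le_L z$ and $x,z\in I$ imply $y\in I$. A $K$-convex partition of $L$ is a partition $(L_k)_{k\in K}$ of $L$ (into nonempty sets) such that $k<_K k'\iff$ every element of $L_k$ is $<_L$ every element of $L_{k'}$. $L\trianglelefteq^{\mathcal{L}}L'$ iff there are $K\in\mathcal{L}$, a $K$-convex partition $(L_k)_{k\in K}$ of $L$, and an embedding $f$ of $L$ into $L'$ such that each $f(L_k)$ is a convex subset of $L'$. $\trianglelefteq^{\mathcal{L}}_\kappa$ is the restriction of $\trianglelefteq^{\mathcal{L}}$ to $\mathrm{LO}_\kappa$. A quasi-order $(X,\precsim)$ embeds into $(Y,\precsim')$ if there is $\varphi:X\to Y$ with $x\precsim x'\iff\varphi(x)\precsim'\varphi(x')$. *)

(* Defs.v *)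
From mathcomp Require Import all_boot all_order all_algebra.
From mathcomp Require Import boolp classical_sets functions cardinality wochoice.

Set Implicit Arguments.
Unset Strict Implicit.
Unset Printing Implicit Defensive.

Local Open Scope classical_set_scope.
Local Open Scope card_scope.

(* Boolean relations lose no generality: under the axioms of [boolp], every
   [T -> T -> Prop] is the truth of some [rel T].
   Nonemptiness is not built into [linOrd]; it is imposed in [Lin]. *)
Record linOrd := LinOrd {
  car :> Type;
  le_of : rel car;
  le_of_total_order : total_order le_of }.

Definition lt_of (L : linOrd) (x y : L) : Prop := le_of x y /\ x <> y.

(* A cardinal is represented by a type of that cardinality. The elements of
   [LO kappa] are nonempty whenever [kappa] is, in particular when it is
   infinite. *)
Record LO (kappa : Type) := MkLO {
  le_LO : rel kappa;
  le_LO_total_order : total_order le_LO }.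

Definition linOrd_of_LO (kappa : Type) (L : LO kappa) : linOrd :=
  LinOrd (le_LO_total_order L).
Coercion linOrd_of_LO : LO >-> linOrd.

Definition embedding (L L' : linOrd) (f : L -> L') : Prop :=
  {mono f : x y / le_of x y}.

Definition embeds (L L' : linOrd) : Prop := exists f : L -> L', embedding f.

Lemma rat_total_order : total_order (fun x y : rat => (x <= y)%R).
Proof.
split; last exact: Order.TotalTheory.le_total.
split; last exact: Order.POrderTheory.le_anti.
by split; [exact: Order.POrderTheory.lexx | exact: Order.POrderTheory.le_trans].
Qed.

Definition ratOrd : linOrd := LinOrd rat_total_order.

(* All nonempty linear orders of size at most [kappa], not only those on
   subsets of [kappa]; a subset of it that is downward closed is automatically
   invariant under isomorphism. *)
Definition Lin (kappa : Type) : set linOrd :=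
  [set L | [set: L] !=set0 /\ [set: L] #<= [set: kappa]].

Definition Scat (kappa : Type) : set linOrd :=
  [set L | Lin kappa L /\ ~ embeds ratOrd L].

Definition downward_closed (kappa : Type) (C : set linOrd) : Prop :=
  forall K L : linOrd, Lin kappa K -> embeds K L -> C L -> C K.

Definition order_convex (L : linOrd) (I : set L) : Prop :=
  forall x y z : L, le_of x y -> le_of y z -> I x -> I z -> I y.

(* [partition] requires the parts to be nonempty. *)
Definition convex_partition (K L : linOrd) (P : K -> set L) : Prop :=
  partition [set: K] P [set: L] /\
  forall k k' : K,
    lt_of k k' <-> (forall x y : L, P k x -> P k' y -> lt_of x y).

Definition piecewise_convex_embeds (C : set linOrd) (L L' : linOrd) : Prop :=
  exists (K : linOrd) (P : K -> set L) (f : L -> L'),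
    [/\ C K, convex_partition P, embedding f
      & forall k : K, order_convex (f @` P k)].

Definition qo_embeds (X Y : Type) (r : X -> X -> Prop) (r' : Y -> Y -> Prop)
  : Prop :=
  exists phi : X -> Y, forall x x' : X, r x x' <-> r' (phi x) (phi x').

Definition piecewise_convex_embeds_LO (kappa : Type) (C : set linOrd)
  (L L' : LO kappa) : Prop := piecewise_convex_embeds C L L'.

Definition upper_cone (kappa : Type) (C : set linOrd) (L0 : LO kappa) :
    set (LO kappa) :=
  [set L | piecewise_convex_embeds_LO C L0 L].

(* Main.v *)
Require Import Defs.
From mathcomp Require Import all_boot all_order all_algebra.
From mathcomp Require Import boolp classical_sets functions cardinality wochoice.

(** Let [X] be an infinite well order, of size at most [kappa], with no convex
    copy in [L0] nor in its reverse. Such an [X] exists because the convex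
    well-ordered subsets of [L0] and of its reverse can be summed up into a
    single well order ([exists_well_ordered_without_copies]). Write [X*] for the
    reverse of [X] and put

      M = Q * X + L0 + Q * X*,

    where [Q * X] is the rationals with every point replaced by a copy of [X].
    The map [phi] replaces every point of [L] by a copy of [M]: [phi L] is the
    lexicographic product [L * M], transported to [kappa] along a bijection
    ([injection_square]: the square of an infinite cardinal is that cardinal).

    Since [L0] is convex in [M], the order [phi L] lies above [L0]; and a
    piecewise convex embedding of [L] into [L'] acts fibrewise, with the same
    index order [K].

    For the converse, convex copies of [X] in [L * M] must meet a summand
    [Q * X], and convex copies of [X*] must meet a summand [Q * X*]
    ([convex_copy_low], [convex_copy_high]). Let [f] be a piecewise convex
    embedding of [L * M] into [L' * M], fix a point [y0] in [L0], and send [l] to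
    the fibre [g l] that contains [f (l, y0)]. As [K] is scattered, some piece
    contains a whole summand [X*] of the fibre over [l], and some piece a whole
    summand [X] of the fibre over a given [l' > l]; if [g l = g l'], then [f]
    puts a point of [Q * X*] below a point of [Q * X] in one fibre, which is
    absurd. So [g] is an embedding. If [(l1, y0)] and [(l2, y0)] belong to one
    piece and [l'] is strictly between [g l1] and [g l2], then the whole fibre
    over [l'] is in the image of [f]. Pulling back a copy of [X] from it gives a
    point of [Q * X] over some [l] that is sent into the fibre over [l'].
    Then [g l = l'], for otherwise a copy of [X*] in the fibre over [l'] would be
    pulled back between the [Q * X] and the [L0] of the fibre over [l]. Hence [g]
    is convex on each piece of the partition of [L] induced by [l |-> (l, y0)]
    ([indexed_convex_embedding_fibres]). *)

Local Open Scope classical_set_scope.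
Local Open Scope card_scope.
Set Implicit Arguments.
Unset Strict Implicit.

(** * Cardinal arithmetic *)

Lemma card_le_setTP (T U : Type) :
  [set: T] #<= [set: U] <-> exists f : T -> U, injective f.
Proof.
split=> [/card_leP[f]|[f fI]].
  exists (fun x => set_val (f (to_setT x))) => x y /val_inj fxy.
  exact: (congr1 val (inj (mem_set Logic.I) (mem_set Logic.I) fxy)).
have fT : set_inj [set: T] f by move=> x y _ _ /fI.
rewrite -(card_le_eql (inj_card_eq fT)).
exact: card_leT.
Qed.

(** Comparability of cardinals: a maximal partial injection has full domain or
    full range. *)
Lemma injection_total (T U : Type) :
  (exists f : T -> U, injective f) \/ (exists g : U -> T, injective g).
Proof.
pose partial_inj : set (set (T * U)) :=
  [set G | forall p q, G p -> G q -> p.1 = q.1 <-> p.2 = q.2].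
have [|G [Ginj Gmax]] := @Zorn_bigcup _ partial_inj.
  move=> F FP Ftot p q [X FX Xp] [Y FY Yq].
  by have [XY|YX] := Ftot _ _ FX FY;
    [apply: (FP _ FY) => //; exact: XY | apply: (FP _ FX) => //; exact: YX].
have [Tdom|/existsNP[t Nt]] := pselect (forall t, exists u, G (t, u)).
  have [f Gf] := choice Tdom.
  by left; exists f => x y fxy; apply/(Ginj _ _ (Gf x) (Gf y)).
have [Udom|/existsNP[u Nu]] := pselect (forall u, exists t, G (t, u)).
  have [f Gf] := choice Udom.
  by right; exists f => x y fxy; apply/(Ginj _ _ (Gf x) (Gf y)).
exfalso; apply: (Gmax (G `|` [set (t, u)])).
  split=> [p Gp|/(_ (t, u))]; first by left.
  by move=> /(_ (or_intror erefl)) Gtu; apply: Nt; exists u.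
move=> [x y] [x' y'] /= [Gp|[-> ->]] [Gq|[-> ->]] //.
- exact: (Ginj _ _ Gp Gq).
- by split=> E; [case: Nt; exists y; rewrite -E | case: Nu; exists x; rewrite -E].
- by split=> E; [case: Nt; exists y'; rewrite E | case: Nu; exists x'; rewrite E].
Qed.

(** The square of an infinite cardinal. Order by inclusion the graphs of the
    injections [g] of [A * A] into [A], for [A] a subset of [T] that is empty or
    contains [u 0] and [u 1], and take a maximal one. If the complement of [A]
    injects into [A], then so does [T], since [u 0] and [u 1] can serve to tell
    [A] from its complement. Otherwise [A] has a disjoint copy, and [g] extends to
    the union of [A] and this copy. *)
Lemma injection_square (T : Type) (u : nat -> T) : injective u ->
  exists f : T * T -> T, injective f.
Proof.
move=> uI.
(* [dom G] is the set [A] on which the pairing with graph [G] is defined. *)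
pose dom (G : set (T * T * T)) x := exists z, G (x, x, z).
pose pairing : set (set (T * T * T)) := fun G =>
  [/\ forall x y z, G (x, y, z) -> [/\ dom G x, dom G y & dom G z],
      forall x y, dom G x -> dom G y -> exists z, G (x, y, z),
      forall p q, G p -> G q -> p.1 = q.1 <-> p.2 = q.2 &
      forall x, dom G x -> dom G (u 0) /\ dom G (u 1)].
have domS G G' x : G `<=` G' -> dom G x -> dom G' x.
  by move=> GG' [z Gz]; exists z; exact: GG'.
have [|G [[Gdom Gtot Ginj Gu] Gmax]] := @Zorn_bigcup _ pairing.
  move=> F FP Ftot; pose V := \bigcup_(X in F) X.
  have sub X : F X -> X `<=` V by move=> FX p Xp; exists X.
  have domV x : dom V x -> exists2 X, F X & dom X x.
    by move=> [z [X FX Xz]]; exists X => //; exists z.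
  split.
  - move=> x y z [X FX Xxyz]; have [P1 _ _ _] := FP _ FX.
    have [dx dy dz] := P1 _ _ _ Xxyz.
    by split; apply: domS (sub _ FX) _.
  - move=> x y /domV[X FX Xx] /domV[Y FY Yy].
    have [XY|YX] := Ftot _ _ FX FY.
      have [_ P2 _ _] := FP _ FY.
      by have [z Yz] := P2 _ _ (domS _ _ _ XY Xx) Yy; exists z, Y.
    have [_ P2 _ _] := FP _ FX.
    by have [z Xz] := P2 _ _ Xx (domS _ _ _ YX Yy); exists z, X.
  - move=> p q [X FX Xp] [Y FY Yq]; have [XY|YX] := Ftot _ _ FX FY.
      by have [_ _ P3 _] := FP _ FY; apply: P3 => //; exact: XY.
    by have [_ _ P3 _] := FP _ FX; apply: P3 => //; exact: YX.
  - move=> x /domV[X FX Xx]; have [_ _ _ P4] := FP _ FX.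
    by have [d0 d1] := P4 _ Xx; split; apply: domS (sub _ FX) _.
have Gfun x y : exists z, dom G x -> dom G y -> G (x, y, z).
  have [dx|ndx] := pselect (dom G x); last by exists x.
  have [dy|ndy] := pselect (dom G y); last by exists x.
  by have [z Gz] := Gtot _ _ dx dy; exists z.
have {}[g Gg] : exists g, forall x y, dom G x -> dom G y -> G (x, y, g x y).
  have [g Gg] := choice (fun p : T * T => Gfun p.1 p.2).
  by exists (fun x y => g (x, y)) => x y; apply: (Gg (x, y)).
have gdom x y : dom G x -> dom G y -> dom G (g x y).
  by move=> dx dy; have [] := Gdom _ _ _ (Gg _ _ dx dy).
have gI x y x' y' : dom G x -> dom G y -> dom G x' -> dom G y' ->
    g x y = g x' y' -> x = x' /\ y = y'.
  move=> dx dy dx' dy' E.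
  by have /= [_ /(_ E)] := Ginj _ _ (Gg _ _ dx dy) (Gg _ _ dx' dy'); case.
have u01 : u 0 <> u 1 by move=> /uI.
(* A maximal pairing is not empty: the infinite sequence [u] carries one. *)
have [d0 d1] : dom G (u 0) /\ dom G (u 1).
  have [[x /Gu//]|G0] := pselect (exists x, dom G x).
  exfalso.
  pose H : set (T * T * T) := fun p =>
    exists m n, p = (u m, u n, u (choice.pickle (m, n))).
  have Hdom m : dom H (u m) by exists (u (choice.pickle (m, m))), m, m.
  have domH x : dom H x -> exists m, x = u m.
    by move=> [z [m [n [-> _ _]]]]; exists m.
  apply: (Gmax H).
    split=> [[[x y] z] /Gdom[dx _ _]|HG]; first by case: G0; exists x.
    by apply: G0; exists (u 0), (u (choice.pickle (0, 0))); apply: HG; exists 0, 0.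
  split.
  - by move=> x y z [m [n [-> -> ->]]]; split; exact: Hdom.
  - move=> x y /domH[m ->] /domH[n ->].
    by exists (u (choice.pickle (m, n))), m, n.
  - move=> p q [m [n ->]] [m' [n' ->]] /=; split=> [[/uI-> /uI->//]|].
    by move=> /uI/(pcan_inj choice.pickleK)[-> ->].
  - by [].
pose A := {x : T | dom G x}; pose B := {x : T | ~ dom G x}.
(* [s] records whether its argument is in [A]. *)
pose s x := if pselect (dom G x) then u 0 else u 1.
have sd x : dom G (s x) by rewrite /s; case: pselect.
have [[k kI]|[j jI]] := injection_total B A.
  pose p x := match pselect (dom G x) with
    | left _ => x | right nd => sval (k (exist _ x nd)) end.
  have pd x : dom G (p x).
    by rewrite /p; case: pselect => // nd; apply: svalP.
  exists (fun xy => g (g (s xy.1) (p xy.1)) (g (s xy.2) (p xy.2))).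
  have spI x y : g (s x) (p x) = g (s y) (p y) -> x = y.
    move=> /(gI _ _ _ _ (sd _) (pd _) (sd _) (pd _))[]; rewrite /s /p.
    case: pselect => dx; case: pselect => dy;
      [by []|by move=> /u01|by move=> /esym/u01|].
    by move=> _ /eq_sig_hprop => /(_ (fun=> @Prop_irrelevance _))/kI[].
  move=> [x y] [x' y'] /= /gI[]; try exact: gdom.
  by move=> /spI-> /spI->.
exfalso.
pose j' x := match pselect (dom G x) with
  | left d => sval (j (exist _ x d)) | right _ => x end.
have j'N x : dom G x -> ~ dom G (j' x).
  by rewrite /j'; case: pselect => // d _; exact: (svalP (j _)).
have j'I x y : dom G x -> dom G y -> j' x = j' y -> x = y.
  rewrite /j'; case: pselect => // dx; case: pselect => // dy _ _.
  by move=> /eq_sig_hprop => /(_ (fun=> @Prop_irrelevance _))/jI[].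
pose D x := dom G x \/ exists2 a, dom G a & x = j' a.
(* [p] is the identity on [A], and the inverse of [j'] on the copy of [A]; the
   values of [s] distinguish the two. *)
have pex x : exists a,
    D x -> dom G a /\ (x = if pselect (dom G x) then a else j' a).
  have [dx|ndx] := pselect (dom G x).
    by exists x; case: pselect.
  have [[a da xa]|nx] := pselect (exists2 a, dom G a & x = j' a).
    by exists a => _; case: pselect.
  by exists x => -[].
have [p pP] := choice pex.
have pd x : D x -> dom G (p x) by move=> /pP[].
have psI x y : D x -> D y -> s x = s y -> p x = p y -> x = y.
  move=> /pP[_ xE] /pP[_ yE]; rewrite {3}xE {3}yE /s.
  by case: pselect => dx; case: pselect => dy;
    [move=> _ ->|move=> /u01|move=> /esym/u01|move=> _ ->].
pose code x y := g (g (s x) (s y)) (g (p x) (p y)).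
have coded x y : D x -> D y -> dom G (code x y).
  move=> Dx Dy; apply: (gdom _ _ (gdom _ _ _ _) (gdom _ _ _ _)) => //.
    exact: pd.
  exact: pd.
have codeI x y x' y' : D x -> D y -> D x' -> D y' ->
    code x y = code x' y' -> x = x' /\ y = y'.
  move=> Dx Dy Dx' Dy' /gI[]; try by apply: gdom => //; exact: pd.
  move=> /gI[]// sx sy /gI[]; try exact: pd.
  by move=> px py; split; exact: psI.
pose h x y := if pselect (dom G x /\ dom G y) then g x y else j' (code x y).
pose H : set (T * T * T) := fun q => [/\ D q.1.1, D q.1.2 & q.2 = h q.1.1 q.1.2].
have hD x y : D x -> D y -> D (h x y).
  move=> Dx Dy; rewrite /h; case: (pselect (_ /\ _)) => [[dx dy]|?].
    by left; exact: gdom.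
  by right; exists (code x y) => //; exact: coded.
have hI x y x' y' : D x -> D y -> D x' -> D y' ->
    h x y = h x' y' -> x = x' /\ y = y'.
  move=> Dx Dy Dx' Dy'; rewrite /h.
  case: (pselect (_ /\ _)) => [[dx dy]|n]; case: (pselect (_ /\ _)) => [[dx' dy']|n'].
  - exact: gI.
  - rewrite /= => E; case: (j'N _ (coded _ _ Dx' Dy')).
    by rewrite -E; exact: gdom.
  - rewrite /= => E; case: (j'N _ (coded _ _ Dx Dy)).
    by rewrite E; exact: gdom.
  - by move=> /j'I => /(_ (coded _ _ Dx Dy) (coded _ _ Dx' Dy')); exact: codeI.
have HD x : D x -> dom H x by exists (h x x).
have DH x : dom H x -> D x by move=> [z []].
apply: (Gmax H).
  split=> [[[x y] z] Gz|HG].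
    have [dx dy _] := Gdom _ _ _ Gz; split; [by left|by left|].
    rewrite /= /h; case: (pselect (_ /\ _)) => [?|[]//] /=.
    by apply/(Ginj _ _ Gz (Gg _ _ dx dy)).
  apply: (j'N _ d0); apply: domS HG _; apply: HD.
  by right; exists (u 0).
split.
- by move=> x y z [/= Dx Dy ->]; split; apply: HD => //; exact: hD.
- by move=> x y /DH Dx /DH Dy; exists (h x y).
- move=> [[x y] z] [[x' y'] z'] [/= Dx Dy ->] [/= Dx' Dy' ->].
  by split=> [[-> ->]//|/hI[]// -> ->].
- by move=> x _; split; apply: HD; left.
Qed.

(** * Linear orders *)

Section LinOrdTheory.
Variable L : linOrd.
Implicit Types x y z : L.

Lemma le_refl x : le_of x x.
Proof. by case: (le_of_total_order L) => [[[]]]. Qed.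

Lemma le_trans y x z : le_of x y -> le_of y z -> le_of x z.
Proof. by case: (le_of_total_order L) => [[[_ T] _] _]; exact: T. Qed.

Lemma le_anti x y : le_of x y -> le_of y x -> x = y.
Proof.
by case: (le_of_total_order L) => [[_ A] _] xy yx; apply: A; rewrite xy yx.
Qed.

Lemma le_total x y : le_of x y \/ le_of y x.
Proof. by apply/orP; case: (le_of_total_order L). Qed.

Lemma ltW x y : lt_of x y -> le_of x y.
Proof. by case. Qed.

Lemma lt_irrefl x : ~ lt_of x x.
Proof. by case. Qed.

Lemma lt_le_trans y x z : lt_of x y -> le_of y z -> lt_of x z.
Proof.
move=> [xy nxy] yz; split; first exact: le_trans xy yz.
by move=> xz; apply: nxy; apply: le_anti => //; rewrite xz.
Qed.

Lemma le_ltP x y : le_of x y \/ lt_of y x.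
Proof.
have [xy|yx] := le_total x y; first by left.
by have [<-|n] := pselect (y = x); [left; exact: le_refl|right].
Qed.

Lemma ltgtP x y : [\/ lt_of x y, x = y | lt_of y x].
Proof.
have [xy|] := le_ltP x y; last by constructor 3.
by have [E|n] := pselect (x = y); [constructor 2|constructor 1].
Qed.

Lemma le_eqVlt x y : le_of x y -> x = y \/ lt_of x y.
Proof. by move=> xy; have [E|n] := pselect (x = y); [left|right]. Qed.

Lemma lt_leF x y : lt_of x y -> le_of y x -> False.
Proof. by move=> xy yx; exact: lt_irrefl (lt_le_trans xy yx). Qed.

End LinOrdTheory.
Arguments le_refl {L} x.

Lemma embedding_inj (L L' : linOrd) (f : L -> L') : embedding f -> injective f.
Proof. by move=> fE x y fxy; apply: le_anti; rewrite -fE fxy; exact: le_refl. Qed.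

Lemma embedding_lt (L L' : linOrd) (f : L -> L') x y : embedding f ->
  lt_of (f x) (f y) <-> lt_of x y.
Proof.
move=> fE; rewrite /lt_of fE; split=> -[xy n]; split=> // E; apply: n.
  by rewrite E.
exact: embedding_inj E.
Qed.

Lemma lt_embedding (L L' : linOrd) (f : L -> L') :
  (forall x y, lt_of x y -> lt_of (f x) (f y)) -> embedding f.
Proof.
move=> fL x y; apply/idP/idP => [fxy|xy]; last first.
  by have [->|/fL/ltW] := le_eqVlt xy; [exact: le_refl|].
have [//|/fL yx] := le_ltP x y.
by case: (lt_leF yx).
Qed.

Lemma total_orderP (T : Type) (r : rel T) :
  (forall x, r x x) -> (forall y x z, r x y -> r y z -> r x z) ->
  (forall x y, r x y -> r y x -> x = y) -> (forall x y, r x y \/ r y x) ->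
  total_order r.
Proof.
move=> R T' A Tot; split; last by move=> x y; apply/orP; exact: Tot.
by split; [split|move=> x y /andP[]; exact: A].
Qed.

Lemma rev_total_order (L : linOrd) : total_order (fun x y : L => le_of y x).
Proof.
apply: total_orderP => [x|y x z xy yz|x y xy yx|x y].
- exact: le_refl.
- exact: le_trans yz xy.
- exact: le_anti.
- exact: le_total.
Qed.

Definition revOrd (L : linOrd) : linOrd := LinOrd (rev_total_order L).

Lemma lt_rev (L : linOrd) (x y : L) :
  @lt_of (revOrd L) x y <-> @lt_of L y x.
Proof. by split=> -[? n]; split => // E; apply: n. Qed.

Lemma pull_total_order (T : Type) (L : linOrd) (f : T -> L) :
  injective f -> total_order (fun x y => le_of (f x) (f y)).
Proof.
move=> fI; apply: total_orderP => [x|y x z|x y xy yx|x y].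
- exact: le_refl.
- exact: le_trans.
- by apply: fI; apply: le_anti.
- exact: le_total.
Qed.

(** The order of [L] pulled back along an injection. *)
Definition pullOrd (T : Type) (L : linOrd) (f : T -> L) (fI : injective f) :
  linOrd := LinOrd (pull_total_order fI).

Lemma sval_inj (T : Type) (S : T -> Prop) : injective (@sval T S).
Proof. by move=> x y; apply: eq_sig_hprop => z; exact: Prop_irrelevance. Qed.

(** The suborder of [L] on the elements that satisfy [S]. *)
Definition subOrd (L : linOrd) (S : L -> Prop) : linOrd :=
  pullOrd (@sval_inj L S).

Lemma unit_total_order : total_order (fun _ _ : unit => true).
Proof. by apply: total_orderP => [||[] []|] //; left. Qed.

Definition unitOrd : linOrd := LinOrd unit_total_order.

Lemma nat_total_order : total_order leq.
Proof.
apply: total_orderP => [x|y x z|x y xy yx|x y] //.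
- exact: leq_trans.
- by apply/eqP; rewrite eqn_leq xy.
- by apply/orP; exact: leq_total.
Qed.

Definition natOrd : linOrd := LinOrd nat_total_order.

Section Sum.
Variables A B : linOrd.

Definition le_sum (x y : A + B) : bool :=
  match x, y with
  | inl a, inl a' => le_of a a'
  | inl _, inr _ => true
  | inr _, inl _ => false
  | inr b, inr b' => le_of b b'
  end.

Lemma sum_total_order : total_order le_sum.
Proof.
apply: total_orderP => [[] x|[y|y] [x|x] [z|z]|[x|x] [y|y]|[x|x] [y|y]] //=.
- exact: le_refl.
- exact: le_refl.
- exact: le_trans.
- exact: le_trans.
- by move=> xy yx; congr inl; exact: le_anti.
- by move=> xy yx; congr inr; exact: le_anti.
- exact: le_total.
- by left.
- by right.
- exact: le_total.
Qed.

(** [A + B], with [A] below [B]. *)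
Definition sumOrd : linOrd := LinOrd sum_total_order.

Lemma lt_inr (b b' : B) : @lt_of sumOrd (inr b) (inr b') <-> lt_of b b'.
Proof. by split=> -[? n]; split=> // E; apply: n; [rewrite E|case: E]. Qed.

End Sum.

Section Product.
Variables A B : linOrd.

Definition le_prod (p q : A * B) : bool :=
  `[< lt_of p.1 q.1 \/ p.1 = q.1 /\ le_of p.2 q.2 >].

Lemma prod_total_order : total_order le_prod.
Proof.
apply: total_orderP => [[a b]|[a b] [a1 b1] [a2 b2]|[a b] [a1 b1]|[a b] [a1 b1]].
- by apply/asboolP; right; split=> //; exact: le_refl.
- move=> /asboolP/= H1 /asboolP/= H2; apply/asboolP => /=.
  case: H1 => [aa|[-> b12]]; case: H2 => [bb|[E bb]].
  + by left; apply: lt_le_trans aa (ltW bb).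
  + by left; rewrite -E.
  + by left.
  + by right; split=> //; exact: le_trans bb.
- move=> /asboolP/= H1 /asboolP/= H2.
  case: H1 => [aa|[E1 b12]]; case: H2 => [bb|[E2 bb]].
  + by case: (lt_leF aa (ltW bb)).
  + by case: aa => _ []; rewrite E2.
  + by case: bb => _ []; rewrite E1.
  + by rewrite E1 (le_anti b12 bb).
- have [aa|->|aa] := ltgtP a a1.
  + by left; apply/asboolP; left.
  + by have [bb|bb] := le_total b b1; [left|right]; apply/asboolP; right.
  + by right; apply/asboolP; left.
Qed.

(** The lexicographic product, with [A] as the dominant coordinate. *)
Definition prodOrd : linOrd := LinOrd prod_total_order.

Lemma le_prodP (p q : prodOrd) :
  le_of p q <-> lt_of p.1 q.1 \/ p.1 = q.1 /\ le_of p.2 q.2.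
Proof. by split=> /asboolP. Qed.

Lemma le_prod1 (p q : prodOrd) : le_of p q -> le_of p.1 q.1.
Proof. by move=> /le_prodP[/ltW//|[-> _]]; exact: le_refl. Qed.

Lemma le_prod_same (a : A) (b b' : B) :
  @le_of prodOrd (a, b) (a, b') = le_of b b'.
Proof.
apply/idP/idP => [/le_prodP[/lt_irrefl//|[]]//|bb].
by apply/le_prodP; right.
Qed.

Lemma lt_prod_same (a : A) (b b' : B) :
  @lt_of prodOrd (a, b) (a, b') <-> lt_of b b'.
Proof.
rewrite /lt_of le_prod_same.
by split=> -[? n]; split=> // E; apply: n; [rewrite E|case: E].
Qed.

Lemma le_prod_between (a : A) (b b' : B) (p : prodOrd) :
  le_of ((a, b) : prodOrd) p -> le_of p ((a, b') : prodOrd) -> p.1 = a.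
Proof. by move=> /le_prod1/= ap /le_prod1/= pa; exact: le_anti. Qed.

Lemma lt_prod1 (p q : prodOrd) : lt_of p.1 q.1 -> lt_of p q.
Proof.
move=> pq; split; first by apply/le_prodP; left.
by move=> E; move: pq; rewrite E => /lt_irrefl.
Qed.

End Product.

(** * Convex copies *)

(** [h] is an isomorphism of [X] with a convex subset of [N]. *)
Definition convex_copy (X N : linOrd) (h : X -> N) : Prop :=
  embedding h /\ forall x z y, le_of (h x) y -> le_of y (h z) ->
    exists w, h w = y.

(** Every nonempty subset has a least element. *)
Definition well_ordered (X : linOrd) : Prop :=
  forall S : X -> Prop, (exists x, S x) ->
    exists x, S x /\ forall y, S y -> le_of x y.

Lemma well_ordered_embedding_ge (X : linOrd) (f : X -> X) :
  well_ordered X -> embedding f -> forall x, le_of x (f x).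
Proof.
move=> Xwo fE x; have [//|fx] := le_ltP x (f x).
have [|y [yf ymin]] := Xwo (fun y => lt_of (f y) y); first by exists x.
have /ymin : lt_of (f (f y)) (f y) by apply/embedding_lt.
by move=> /(lt_leF yf).
Qed.

(** A convex copy of a well order cannot reach a set that lies above one of its
    elements and has no least element. *)
Lemma convex_copy_below (X N : linOrd) (h : X -> N) (x0 : X) (T : N -> Prop) :
  well_ordered X -> convex_copy h -> (forall t, T t -> le_of (h x0) t) ->
  (forall t, T t -> exists2 t', T t' & lt_of t' t) ->
  forall x t, T t -> lt_of (h x) t.
Proof.
move=> Xwo [hE hC] T0 Tlow x t Tt.
have [th|//] := le_ltP t (h x).
have [x1 hx1] := hC x0 x t (T0 _ Tt) th.
have [|y [Ty ymin]] := Xwo (fun y => T (h y)); first by exists x1; rewrite hx1.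
have [t' Tt' t'y] := Tlow _ Ty.
have [w hw] := hC x0 y t' (T0 _ Tt') (ltW t'y).
have : le_of y w by apply: ymin; rewrite hw.
by rewrite -hE hw => /(lt_leF t'y).
Qed.

Lemma not_embeds_rev (X : linOrd) (u : nat -> X) :
  well_ordered X -> (forall n, lt_of (u n) (u n.+1)) -> ~ embeds X (revOrd X).
Proof.
move=> Xwo uS [f fE].
have [|x [[n ->] xmin]] := Xwo (fun y => exists n, y = f (u n)).
  by exists (f (u 0)), 0.
have /lt_rev/lt_leF := (embedding_lt (u n) (u n.+1) fE).2 (uS n).
by apply; apply: xmin; exists n.+1.
Qed.

Lemma convex_copy_pullback (X N N' : linOrd) (f : N -> N') (D : X -> N') :
  embedding f -> convex_copy D -> (forall x, exists y, f y = D x) ->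
  exists2 h : X -> N, convex_copy h & forall x, f (h x) = D x.
Proof.
move=> fE [DE DC] /choice[h fh]; exists h => //; split=> [x y|x z y].
  by rewrite -fE !fh DE.
rewrite -fE -[le_of y _]fE !fh => xy yz.
have [w Dw] := DC _ _ _ xy yz; exists w.
by apply: (embedding_inj fE); rewrite fh.
Qed.

(** * A long well order *)

Lemma exists_well_ordered (T : Type) :
  exists (r : rel T) (rT : total_order r), well_ordered (LinOrd rT).
Proof.
have [r rwo] := well_ordering_principle ({classic T} : eqType).
have min (S : T -> Prop) x : S x -> exists z, S z /\ forall y, S y -> r z y.
  move=> Sx.
  have [|z [[Sz zmin] _]] := rwo (fun y => `[< S y >]).
    by exists x; apply/asboolP.
  exists z; split; first by move/asboolP: Sz.
  by move=> y Sy; apply: zmin; apply/asboolP.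
have r_refl x : r x x.
  by have [_ [<- zmin]] := min (eq x) x erefl; exact: zmin.
have r_anti x y : r x y -> r y x -> x = y.
  move=> xy yx.
  have [|z [_ zuniq]] := rwo (fun z => `[< z = x \/ z = y >]).
    by exists x; apply/asboolP; left.
  transitivity z; [symmetry|]; apply: zuniq; split.
  - by apply/asboolP; left.
  - by move=> w /asboolP[->|->].
  - by apply/asboolP; right.
  - by move=> w /asboolP[->|->].
have rT : total_order r.
  apply: total_orderP => [//|y x z xy yz|//|x y].
    have [_ [[->|->|->] zmin]] := min (fun w => [\/ w = x, w = y | w = z]) x (Or31 _ _ erefl).
    - by apply: zmin; constructor 3.
    - rewrite (r_anti x y) //; by apply: zmin; constructor 1.
    - rewrite -(r_anti y z) //; by apply: zmin; constructor 2.
  have [_ [[->|->] zmin]] := min (fun w => w = x \/ w = y) x (or_introl erefl).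
    by left; apply: zmin; right.
  by right; apply: zmin; left.
by exists r, rT => S [x Sx]; exact: min Sx.
Qed.

Lemma well_ordered_sum (A B : linOrd) :
  well_ordered A -> well_ordered B -> well_ordered (sumOrd A B).
Proof.
move=> Awo Bwo S [x0 Sx0].
have [/Awo[a [Sa amin]]|nA] := pselect (exists a, S (inl a)).
  by exists (inl a); split=> // -[b|//] /amin.
have Sa a : ~ S (inl a) by move=> Sa; apply: nA; exists a.
have [|b [Sb bmin]] := Bwo (fun b => S (inr b)).
  by case: x0 Sx0 => [a /Sa//|b Sb]; exists b.
by exists (inr b); split=> // -[a /Sa|c /bmin].
Qed.

Lemma well_ordered_unit : well_ordered unitOrd.
Proof. by move=> S [x Sx]; exists x. Qed.

Lemma well_ordered_nat : well_ordered natOrd.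
Proof.
move=> S [n Sn].
have [|m /asboolP Sm mmin] := @ex_minnP (fun n => `[< S n >]).
  by exists n; apply/asboolP.
by exists m; split=> // k Sk; apply: mmin; apply/asboolP.
Qed.

(** Every linear order [L] is outgrown by some infinite well order [X], of size
    bounded in terms of [L]. The witness is [nat + (a + 1)], where [a] is the
    sum, along a well-ordering of [L], of the maximal well-ordered convex sets
    [{y | [x, y] is well ordered}] with a least element [x]. A convex copy of
    [X] in [L] would lie in one of these sets, and hence [a + 1] would embed
    into [a]. *)
Lemma exists_well_ordered_without_copies (L : linOrd) :
  exists (X : linOrd) (u : nat -> X),
    [/\ well_ordered X,
        forall n, lt_of (u n) (u n.+1),
        forall h : X -> L, ~ convex_copy h &
        exists i : X -> nat + (L * L + unit), injective i].
Proof.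
have [r [rT rwo]] := exists_well_ordered L.
pose R := LinOrd rT.
pose seg (x y : L) := le_of x y /\
  forall S : L -> Prop, (exists z, S z) ->
    (forall z, S z -> le_of x z /\ le_of z y) ->
    exists z, S z /\ forall z', S z' -> le_of z z'.
pose A := @subOrd (prodOrd R L) (fun p => seg p.1 p.2).
have Awo : well_ordered A.
  move=> S [p0 Sp0].
  have [|x [[y [xy Sxy]] xmin]] :=
    rwo (fun x => exists y (xy : seg x y), S (exist _ (x, y) xy)).
    by case: p0 Sp0 => -[x y] xy Sxy; exists x, y, xy.
  have [||z [[[xz Sxz] zy] zmin]] := xy.2
      (fun z => (exists xz : seg x z, S (exist _ (x, z) xz)) /\ le_of z y).
  - by exists y; split; [exists xy|exact: le_refl].
  - by move=> z [[xz _] zy]; split=> //; case: xz.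
  exists (exist _ (x, z) xz); split=> // -[[x' z'] xz'] Sz'.
  apply/le_prodP => /=.
  have /(@le_eqVlt R)[E|] : le_of (l := R) x x'; [|right|by left].
    by apply: xmin; exists z', xz'.
  subst x'; split=> //; have [z'y|yz'] := le_total z' y.
    by apply: zmin; split=> //; exists xz'.
  exact: le_trans zy _.
exists (sumOrd natOrd (sumOrd A unitOrd)), inl; split.
- apply: well_ordered_sum; first exact: well_ordered_nat.
  by apply: well_ordered_sum => //; exact: well_ordered_unit.
- by move=> n; split=> [|[] /n_Sn]; first exact: leqnSn.
- move=> h hC; have [hE hR] := hC.
  pose x0 : sumOrd natOrd (sumOrd A unitOrd) := inl 0.
  have x0min x : le_of x0 x by case: x.
  have hseg x : seg (h x0) (h x).
    split; first by rewrite hE.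
    move=> S [z Sz] Sseg.
    have hS z' : S z' -> exists w, h w = z'.
      by move=> /Sseg[? ?]; apply: (hR x0 x).
    have [|w [Sw wmin]] := well_ordered_sum well_ordered_nat
      (well_ordered_sum Awo well_ordered_unit) (S := fun w => S (h w)).
      by have [w hw] := hS _ Sz; exists w; rewrite hw.
    exists (h w); split=> // z' Sz'; have [w' hw'] := hS _ Sz'.
    by rewrite -hw' hE; apply: wmin; rewrite hw'.
  pose j x : A := exist _ (h x0, h x) (hseg x).
  have jE : embedding j by move=> x y; rewrite -(hE x y); exact: le_prod_same.
  pose top : A := j (inr (inr tt)).
  have kE : embedding (fun a : A => j (inr (inl a))).
    by move=> a b; rewrite jE.
  have := well_ordered_embedding_ge Awo kE top.
  by rewrite jE.
- exists (fun x => match x with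
    | inl n => inl n
    | inr (inl a) => inr (inl (sval a))
    | inr (inr t) => inr (inr t) end).
  move=> [m|[a|[]]] [n|[b|[]]] //= [].
    by move=> ->.
  by move=> /sval_inj->.
Qed.

(** * Convex copies in products with a sandwich *)

Section Fibre.
Variables X Y Z : linOrd.

(** The order [Q * X + Y + Q * Z]: dense sums of copies of [X] and of [Z], below
    and above [Y]. *)
Definition sandwich : linOrd :=
  sumOrd (sumOrd (prodOrd ratOrd X) Y) (prodOrd ratOrd Z).

Definition lowpt (q : rat) (x : X) : sandwich := inl (inl (q, x)).
Definition midpt (y : Y) : sandwich := inl (inr y).
Definition highpt (q : rat) (z : Z) : sandwich := inr (q, z).

End Fibre.

Lemma lt_ratP (q r : ratOrd) : lt_of q r <-> (q < r :> rat)%R.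
Proof.
rewrite /lt_of Order.POrderTheory.lt_neqAle; split=> [[qr n]|/andP[/eqP n qr]].
  by apply/andP; split=> //; apply/eqP.
by split.
Qed.

Lemma ltr_sub1 (q : rat) : @lt_of ratOrd (q - 1)%R q.
Proof. by apply/lt_ratP; rewrite Num.Theory.ltrBlDr Num.Theory.ltrDl. Qed.

Section LowCopy.
Variables (L X Y : linOrd) (u : nat -> X).
Hypothesis X_wo : well_ordered X.
Hypothesis u_lt : forall n, lt_of (u n) (u n.+1).
Hypothesis X_Y : forall h : X -> Y, ~ convex_copy h.

Let N := prodOrd L (sandwich X Y (revOrd X)).

(** A convex copy of [X] meets some [Q * X]: its least element cannot be in [Y], nor in [Q * X*]: by
    [convex_copy_below], the copy would be trapped in [Y] in the former case
    and, in the latter, in one of the summands [X*]. *)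
Lemma convex_copy_low (h : X -> N) : convex_copy h ->
  exists x l q x', h x = (l, lowpt _ _ q x').
Proof.
move=> hC; have [hE hR] := hC.
have [|x0 [_ x0min]] := X_wo (S := fun=> True); first by exists (u 0).
have hx0 x : le_of (h x0) (h x) by rewrite hE; exact: x0min.
case E0 : (h x0) => [l [[[q x']|y]|[q x']]].
- by exists x0, l, q, x'.
- pose T (t : N) := exists q x', t = (l, highpt _ _ q x').
  have Tbelow : forall x t, T t -> lt_of (h x) t.
    apply: (convex_copy_below X_wo hC (x0 := x0)) => t [q [x' ->]].
      by rewrite E0 le_prod_same.
    exists (l, highpt _ _ (q - 1)%R x'); first by exists (q - 1)%R, x'.
    exact/lt_prod_same/lt_inr/lt_prod1/ltr_sub1.
  have hY x : exists y', h x = (l, midpt _ _ y').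
    have hx := Tbelow x _ (ex_intro _ 0%R (ex_intro _ (u 0) erefl)).
    have := hx0 x; move: (Tbelow x); rewrite E0.
    case E : (h x) hx => [l' m] hx Thx h0x.
    have /= El := le_prod_between h0x (ltW hx).
    subst l'; move: h0x; rewrite le_prod_same.
    case: m {hx} E Thx => [[//|y']|[q x']] E Thx _; first by exists y'.
    by case: (lt_irrefl (Thx (l, highpt _ _ q x') _)); exists q, x'.
  have [k hk] := choice hY; case: (X_Y (h := k)); split=> [x x'|x z y' xy yz].
    by rewrite -hE !hk le_prod_same.
  have [||w hw] := hR x z (l, midpt _ _ y'); rewrite ?hk ?le_prod_same //.
  by exists w; move: hw; rewrite hk => -[].
- pose T (t : N) := exists q' x'', t = (l, highpt _ _ q' x'') /\ (q < q')%R.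
  have Tbelow : forall x t, T t -> lt_of (h x) t.
    apply: (convex_copy_below X_wo hC (x0 := x0)) => t [q' [x'' [-> qq']]].
      by rewrite E0 le_prod_same; apply/le_prodP; left; apply/lt_ratP.
    have [lb ub] := Num.Theory.midf_lt qq'.
    exists (l, highpt _ _ ((q + q') / 2%:R)%R x'').
      by exists ((q + q') / 2%:R)%R, x''.
    by apply/lt_prod_same/lt_inr/lt_prod1/lt_ratP.
  have hX x : exists x'', h x = (l, highpt _ _ q x'').
    have T1 : T (l, highpt _ _ (q + 1)%R (u 0)).
      by exists (q + 1)%R, (u 0); split=> //; rewrite Num.Theory.ltrDl.
    have hx := Tbelow x _ T1.
    have := hx0 x; move: (Tbelow x); rewrite E0.
    case E : (h x) hx => [l' m] hx Thx h0x.
    have /= El := le_prod_between h0x (ltW hx).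
    subst l'; move: h0x; rewrite le_prod_same.
    case: m {hx} E Thx => [//|[q' x'']] E Thx /le_prodP/= [/lt_ratP qq'|[-> _]].
      by case: (lt_irrefl (Thx (l, highpt _ _ q' x'') _)); exists q', x''.
    by exists x''.
  have [k hk] := choice hX; case: (not_embeds_rev X_wo u_lt).
  exists k => x x''; rewrite -hE !hk le_prod_same.
  by apply/esym; exact: le_prod_same.
Qed.

End LowCopy.

(** Reversing [Q * X + Y + Q * X*] gives [Q * X + Y* + Q * X*], because [Q] is
    isomorphic to its reverse. *)
Definition sandwich_flip (X Y : linOrd) (m : sandwich X Y (revOrd X)) :
    sandwich X (revOrd Y) (revOrd X) :=
  match m with
  | inl (inl (q, x)) => highpt _ _ (- q)%R x
  | inl (inr y) => midpt _ _ y
  | inr (q, x) => lowpt _ _ (- q)%R x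
  end.

Lemma sandwich_flipK (X Y : linOrd) (m : sandwich X Y (revOrd X)) :
  @sandwich_flip X (revOrd Y) (sandwich_flip m) = m.
Proof. by case: m => [[[q x]|y]|[q x]] //=; rewrite GRing.opprK. Qed.

Lemma sandwich_flip_le (X Y : linOrd) (m n : sandwich X Y (revOrd X)) :
  le_of (sandwich_flip m) (sandwich_flip n) = le_of n m.
Proof.
have lt_opp (q r : rat) : @lt_of ratOrd (- q)%R (- r)%R <-> @lt_of ratOrd r q.
  by split=> /lt_ratP H; apply/lt_ratP; move: H; rewrite Num.Theory.ltrN2.
case: m => [[[q x]|y]|[q x]]; case: n => [[[q' x']|y']|[q' x']] //=.
- apply/asboolP/asboolP => /= -[/lt_opp|[]]; [by left| |by left|].
    by move=> /GRing.oppr_inj->; right.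
  by move=> ->; right.
- apply/asboolP/asboolP => /= -[/lt_opp|[]]; [by left| |by left|].
    by move=> /GRing.oppr_inj->; right.
  by move=> ->; right.
Qed.

(** [convex_copy_low] for the reverse order; a convex copy of [X] in the reverse
    of an order is a convex copy of [X*] in that order. *)
Lemma convex_copy_high (L X Y : linOrd) (u : nat -> X)
    (h : X -> revOrd (prodOrd L (sandwich X Y (revOrd X)))) :
  well_ordered X -> (forall n, lt_of (u n) (u n.+1)) ->
  (forall k : X -> revOrd Y, ~ convex_copy k) -> convex_copy h ->
  exists x l q x', h x = (l, highpt _ _ q x').
Proof.
move=> Xwo uS XY [hE hR].
pose flip (p : L * sandwich X Y (revOrd X)) :
  prodOrd (revOrd L) (sandwich X (revOrd Y) (revOrd X)) := (p.1, sandwich_flip p.2).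
have flipE p p' : le_of (flip p) (flip p') =
    @le_of (prodOrd L (sandwich X Y (revOrd X))) p' p.
  apply/idP/idP => /le_prodP[/lt_rev lt1|[E le2]]; apply/le_prodP.
  - by left.
  - by right; split; [symmetry|rewrite -sandwich_flip_le].
  - by left.
  - by right; split; [symmetry|rewrite sandwich_flip_le].
have [|x [l [q [x' E]]]] := convex_copy_low Xwo uS XY (h := flip \o h).
  split=> [x x'|x z [l m] /=]; first by rewrite flipE; exact: hE.
  pose p := (l, @sandwich_flip X (revOrd Y) m).
  have -> : (l, m) = flip p.
    by congr pair; symmetry; exact: (@sandwich_flipK X (revOrd Y)).
  move=> xp pz; have [||w <-] := hR x z p; last by exists w.
    exact: etrans (esym (flipE (h x) p)) xp.
  exact: etrans (esym (flipE p (h z))) pz.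
exists x, l, (- q)%R, x'.
move: E; rewrite /= /flip; case: (h x) => l' m /= [-> Em].
by rewrite -[m]sandwich_flipK Em.
Qed.

(** * Piecewise convex embeddings as pairs of maps *)

(** The map [c] sends a point to the index of its piece, so that the pieces are
    the nonempty fibres of [c]; it need not be onto [K]. Convexity of the image
    of a piece is stated between two points [f x] and [f z] of this image: the
    point [w] then lies between [x] and [z], hence in the same piece. *)
Definition indexed_convex_embedding (K L L' : linOrd) (c : L -> K)
    (f : L -> L') : Prop :=
  [/\ forall x y, le_of x y -> le_of (c x) (c y), embedding f &
      forall x z y, c x = c z -> le_of (f x) y -> le_of y (f z) ->
        exists w, f w = y].

(** From right to left, [K] is replaced by the range of [c], which is in [C] by
    downward closure. *)
Lemma piecewise_convex_embedsP (kappa : Type) (C : set linOrd) (L L' : linOrd)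
    (l : L) :
  C `<=` Lin kappa -> downward_closed kappa C ->
  piecewise_convex_embeds C L L' <->
  exists (K : linOrd) (c : L -> K) (f : L -> L'),
    C K /\ indexed_convex_embedding c f.
Proof.
move=> CLin Cdown; split=> [[K [P [f [CK [[Pcov _ _] Plt] fE fP]]]]|].
  have /choice[c Pc] x : exists k, P k x.
    have : [set: L] x by [].
    by rewrite -Pcov => -[k _ Pkx]; exists k.
  exists K, c, f; split=> //; split=> // [x y xy|x z y cxz xy yz].
    have [//|/Plt cyx] := le_ltP (c x) (c y).
    by case: (lt_leF (cyx _ _ (Pc y) (Pc x))).
  have [||w _ <-] := fP (c x) (f x) y (f z) xy yz; last by exists w.
    by exists x.
  by exists z => //; rewrite cxz.
move=> [K [c [f [CK [cM fE fP]]]]].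
pose K' := @subOrd K (fun k => exists x, c x = k).
pose P (k : K') : set L := [set x | c x = sval k].
have CK' : C K'.
  apply: (Cdown _ _ _ _ CK); last by exists sval.
  split; first by exists (exist _ (c l) (ex_intro _ l erefl)).
  have [_] := CLin _ CK; apply: card_le_trans.
  by apply/card_le_setTP; exists sval; exact: sval_inj.
exists K', P, f; split=> //.
- split; [split|] => [|k k' _ _ [x [/= Pkx Pk'x]]|k _|k k'].
  + apply/seteqP; split=> // x _.
    by exists (exist _ (c x) (ex_intro _ x erefl)).
  + by apply: sval_inj; rewrite -Pkx -Pk'x.
  + by case: k => k [x cx]; exists x.
  + split=> [kk' x y Px Py|kk'].
      have [yx|//] := le_ltP y x; exfalso.
      apply: (lt_leF kk'); rewrite /= -Px -Py; exact: cM.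
    have [x cx] := svalP k; have [y cy] := svalP k'.
    have [//|E|k'k] := ltgtP k k'.
      by subst k'; case: (lt_irrefl (kk' x x cx cx)).
    have := cM _ _ (ltW (kk' x y cx cy)); rewrite cx cy.
    by move=> /(@lt_leF K' _ _ k'k).
- move=> k x' y z' xy yz [x Px xx'] [z Pz zz']; subst x' z'.
  have [w fw] := fP x z y (etrans Px (esym Pz)) xy yz; exists w => //.
  rewrite /P /= -Px; apply: le_anti; last by apply: cM; rewrite -fE fw.
  by rewrite (etrans Px (esym Pz)); apply: cM; rewrite -fE fw.
Qed.

Lemma indexed_convex_embedding_iso (K L1 L1' L2 L2' : linOrd) (c : L2 -> K)
    (f : L2 -> L2') (e : L1 -> L2) (d : L2' -> L1') :
  embedding e -> (forall y, exists x, e x = y) ->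
  embedding d -> (forall y, exists x, d x = y) ->
  indexed_convex_embedding c f ->
  indexed_convex_embedding (c \o e) (d \o f \o e).
Proof.
move=> eE eS dE dS [cM fE fC]; split=> [x y xy|x y|x z y cxz] /=.
- by apply: cM; rewrite eE.
- by rewrite dE fE eE.
- have [y' <-] := dS y; rewrite !dE => xy yz.
  have [w' <-] := fC _ _ _ cxz xy yz; have [w <-] := eS w'.
  by exists w.
Qed.

(** A monotone map from [Q * X] to a scattered order is constant on some of the
    summands [X]: otherwise it would be injective on a copy of [Q]. *)
Lemma scattered_index_constant (K X : linOrd) (c : prodOrd ratOrd X -> K) (x0 : X) :
  ~ embeds ratOrd K -> (forall p q, le_of p q -> le_of (c p) (c q)) ->
  exists q, forall x y, c (q, x) = c (q, y).
Proof.
move=> Kscat cM; apply: contrapT => nq; apply: Kscat.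
exists (fun q => c (q, x0)); apply: lt_embedding => q r qr; split.
  by apply: cM; exact/ltW/lt_prod1.
move=> cqr; apply: nq; exists ((q + r) / 2%:R)%R => x y.
have [qm mr] := Num.Theory.midf_lt ((lt_ratP _ _).1 qr).
suff cE z : c (((q + r) / 2%:R)%R, z) = c (q, x0) by rewrite !cE.
apply: le_anti; last by apply: cM; apply/ltW/lt_prod1/lt_ratP.
by rewrite cqr; apply: cM; apply/ltW/lt_prod1/lt_ratP.
Qed.

(** * Embeddings between products with a sandwich *)

Section Fibred.
Variables (X Y : linOrd) (u : nat -> X) (y0 : Y).
Hypothesis X_wo : well_ordered X.
Hypothesis u_lt : forall n, lt_of (u n) (u n.+1).
Hypothesis X_Y : forall h : X -> Y, ~ convex_copy h.
Hypothesis X_revY : forall h : X -> revOrd Y, ~ convex_copy h.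

Local Notation M := (sandwich X Y (revOrd X)).

Lemma indexed_convex_embedding_prod (K L L' : linOrd) (c : L -> K) (f : L -> L') :
  indexed_convex_embedding c f ->
  indexed_convex_embedding (fun p : prodOrd L M => c p.1)
    (fun p => (f p.1, p.2) : prodOrd L' M).
Proof.
move=> [cM fE fC]; split=> [p q /le_prod1/cM//|p q|p q [l m] cpq pl lq].
  apply/idP/idP => /le_prodP[/= lt1|[/= E le2]]; apply/le_prodP.
  - by left; apply/(embedding_lt _ _ fE).
  - by right; split=> //; exact: embedding_inj E.
  - by left; apply/(embedding_lt _ _ fE).
  - by right; rewrite /= E.
have [l' /= fl'] := fC _ _ _ cpq (le_prod1 pl) (le_prod1 lq).
by exists (l', m); rewrite /= fl'.
Qed.

Lemma low_copy (L : linOrd) (l : L) (q : rat) :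
  convex_copy (fun x => (l, lowpt _ _ q x) : prodOrd L M).
Proof.
split=> [x y|x z [l' m] xp pz]; first by rewrite !le_prod_same; exact: le_prod_same.
have /= El := le_prod_between xp pz; subst l'; move: xp pz.
rewrite !le_prod_same; case: m => [[[q' w]|//]|//] xp pz.
have /= Eq := @le_prod_between ratOrd X _ _ _ _ xp pz.
by exists w; rewrite Eq.
Qed.

Lemma high_copy (L : linOrd) (l : L) (q : rat) :
  @convex_copy X (revOrd (prodOrd L M)) (fun x => (l, highpt _ _ q x)).
Proof.
split=> [x y|x z [l' m] px zp].
  rewrite -[RHS](@le_prod_same ratOrd (revOrd X) q y x).
  exact: (@le_prod_same L M l (highpt _ _ q y) (highpt _ _ q x)).
have /= El := le_prod_between zp px; subst l'.
have {}zp : @le_of M (highpt _ _ q z) m := etrans (esym (le_prod_same l _ _)) zp.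
have {}px : @le_of M m (highpt _ _ q x) := etrans (esym (le_prod_same l _ _)) px.
case: m zp px => [//|[q' w]] zp px.
have /= Eq := @le_prod_between ratOrd (revOrd X) _ _ _ _ zp px.
by exists w; rewrite Eq.
Qed.

(** An embedding between the products induces one between the bases: [l] goes
    to the fibre that contains the image of the point [(l, y0)]. *)
Lemma indexed_convex_embedding_fibres (K L L' : linOrd)
    (c : prodOrd L M -> K) (f : prodOrd L M -> prodOrd L' M) :
  ~ embeds ratOrd K -> indexed_convex_embedding c f ->
  indexed_convex_embedding (fun l => c (l, midpt _ _ y0))
    (fun l => (f (l, midpt _ _ y0)).1).
Proof.
move=> Kscat [cM fE fC]; pose mk l : prodOrd L M := (l, midpt _ _ y0).
have image_copy (i : X -> prodOrd L M) : (forall x y, c (i x) = c (i y)) ->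
    convex_copy i -> convex_copy (f \o i).
  move=> ci [iE iC]; split=> [x y|x z y xy yz]; first by rewrite -iE; exact: fE.
  have [w fw] := fC _ _ _ (ci x z) xy yz; subst y.
  have xw := etrans (esym (fE _ _)) xy; have wz := etrans (esym (fE _ _)) yz.
  by have [v <-] := iC _ _ _ xw wz; exists v.
have image_copy_rev (i : X -> revOrd (prodOrd L M)) :
    (forall x y, c (i x) = c (i y)) -> convex_copy i ->
    convex_copy (f \o i : X -> revOrd (prodOrd L' M)).
  move=> ci [iE iC]; split=> [x y|x z y yx zy].
    by rewrite -iE; exact: fE.
  have [w fw] := fC _ _ _ (ci z x) zy yx; subst y.
  have xw := etrans (esym (fE _ _)) yx; have wz := etrans (esym (fE _ _)) zy.
  by have [v <-] := iC _ _ _ xw wz; exists v.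
have gM l l' : le_of l l' -> le_of (f (mk l)).1 (f (mk l')).1.
  move=> ll'; apply: le_prod1; rewrite fE; apply/le_prodP.
  by have [->|] := le_eqVlt ll'; [right; split=> //; exact: le_refl|left].
have gI l l' : lt_of l l' -> (f (mk l)).1 <> (f (mk l')).1.
  move=> ll' E.
  (* A copy of [X*] above [mk l] and a copy of [X] below [mk l'] are mapped
     into one fibre, in the wrong order. *)
  have [q cq] : exists q, forall x y : X,
      c (l, highpt _ _ q x) = c (l, highpt _ _ q y).
    apply: (@scattered_index_constant K (revOrd X)
      (fun p => c (l, inr p)) (u 0) Kscat) => p p' pp'.
    by apply: cM; rewrite le_prod_same.
  have [q' cq'] : exists q, forall x y : X,
      c (l', lowpt _ _ q x) = c (l', lowpt _ _ q y).
    apply: (@scattered_index_constant K X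
      (fun p => c (l', inl (inl p))) (u 0) Kscat) => p p' pp'.
    by apply: cM; rewrite le_prod_same.
  have [x [k [r [x' E1]]]] := convex_copy_high X_wo u_lt X_revY
    (image_copy_rev _ cq (high_copy l q)).
  have [y [k' [r' [y' E2]]]] := convex_copy_low X_wo u_lt X_Y
    (image_copy _ cq' (low_copy l' q')).
  have ab : le_of (f (mk l)) (f (l, highpt _ _ q x)) by rewrite fE le_prod_same.
  have bc : lt_of (f (l, highpt _ _ q x)) (f (l', lowpt _ _ q' y)).
    by apply/(embedding_lt _ _ fE); exact: lt_prod1.
  have cd : le_of (f (l', lowpt _ _ q' y)) (f (mk l')) by rewrite fE le_prod_same.
  rewrite /= in E1 E2; rewrite E1 in ab bc; rewrite E2 in bc cd.
  have kk' : k = k'.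
    apply: le_anti; first exact: (le_prod1 (ltW bc)).
    by apply: le_trans (le_prod1 cd) _; rewrite -E; exact: (le_prod1 ab).
  by have := ltW bc; rewrite kk' le_prod_same.
have gL l l' : lt_of l l' -> lt_of (f (mk l)).1 (f (mk l')).1.
  by move=> ll'; split; [exact: gM (ltW ll')|exact: gI].
split=> [l l' ll'|l l'|l1 l2 l' c12 l1l' l'l2].
- apply: cM; apply/le_prodP.
  by have [->|] := le_eqVlt ll'; [right; split=> //; exact: le_refl|left].
- exact: (lt_embedding gL).
have [l1E|lt1] := le_eqVlt l1l'; first by exists l1.
have [l2E|lt2] := le_eqVlt l'l2; first by exists l2.
(* The whole fibre over [l'] lies in the image of one piece. *)
have fibre_im m : exists p, f p = (l', m).
  by apply: fC c12 _ _; apply/ltW/lt_prod1.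
have [h hC fh] := convex_copy_pullback fE (low_copy l' 0%R)
  (fun x => fibre_im (lowpt _ _ 0%R x)).
have [x [l [q [x' hx]]]] := convex_copy_low X_wo u_lt X_Y hC.
exists l.
have below : le_of (f (h x)) (f (mk l)) by rewrite fE hx le_prod_same.
have : le_of l' (f (mk l)).1 by move/le_prod1: below; rewrite fh.
move=> /le_eqVlt[//|lt_l']; exfalso.
have [|||h' hC' fh'] := @convex_copy_pullback X (revOrd (prodOrd L M))
  (revOrd (prodOrd L' M)) f (fun x => (l', highpt _ _ 0%R x)).
- by move=> p p'; exact: fE.
- exact: high_copy.
- by move=> z; exact: fibre_im.
(* A copy of [X*] lies between a point of the lower part of the fibre over [l]
   and the middle part of the same fibre. *)
have [y [k [r [y' hy]]]] := convex_copy_high X_wo u_lt X_revY hC'.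
have lo : @le_of (prodOrd L M) (h x) (h' y) by rewrite -fE fh fh' le_prod_same.
have hi : @lt_of (prodOrd L M) (h' y) (mk l).
  by apply/(embedding_lt _ _ fE); rewrite fh'; exact: lt_prod1.
rewrite hx in lo; have kl := le_prod_between lo (ltW hi).
rewrite hy in kl hi; have {}kl : k = l := kl; rewrite kl in hi.
by have := ltW hi; rewrite le_prod_same.
Qed.

End Fibred.

(** * Embedding into the upper cone *)

Section Small.
Variable kappa : Type.
Hypothesis kappa_infinite : infinite_set [set: kappa].

Lemma infinite_seq : exists u : nat -> kappa, injective u.
Proof. by apply/card_le_setTP/infiniteP. Qed.

Lemma card_le_infinite_prod (T U : Type) :
  [set: T] #<= [set: kappa] -> [set: U] #<= [set: kappa] ->
  [set: T * U] #<= [set: kappa].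
Proof.
move=> /card_le_setTP[f fI] /card_le_setTP[g gI].
have [u uI] := infinite_seq; have [h hI] := injection_square uI.
apply/card_le_setTP; exists (fun p => h (f p.1, g p.2)).
by move=> [a b] [a' b'] /hI[/fI-> /gI->].
Qed.

Lemma card_le_infinite_countable (T : countType) : [set: T] #<= [set: kappa].
Proof.
have [u uI] := infinite_seq; apply/card_le_setTP.
by exists (u \o choice.pickle) => x y /uI/(pcan_inj choice.pickleK).
Qed.

Lemma card_le_infinite_sum (T U : Type) :
  [set: T] #<= [set: kappa] -> [set: U] #<= [set: kappa] ->
  [set: T + U] #<= [set: kappa].
Proof.
move=> /card_le_setTP[f fI] /card_le_setTP[g gI].
apply: card_le_trans (card_le_infinite_prod (card_le_infinite_countable bool)
  (card_lexx [set: kappa])).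
apply/card_le_setTP; exists (fun s => match s with
  | inl a => (true, f a) | inr b => (false, g b) end).
by move=> [a|b] [a'|b'] //= [] => [/fI->|/gI->].
Qed.

Lemma infinite_prod_bij (T : Type) (t : T) : [set: T] #<= [set: kappa] ->
  exists (e : kappa -> kappa * T) (d : kappa * T -> kappa), cancel e d /\ cancel d e.
Proof.
move=> Tk.
have /card_bijP[e eb] : [set: kappa] #= [set: kappa * T].
  rewrite card_eq_le card_le_infinite_prod // andbT.
  by apply/card_le_setTP; exists (fun x => (x, t)) => x y [].
have [d ed de] := eb.
exists (fun x => set_val (e (to_setT x))), (fun p => set_val (d (to_setT p))).
split=> x.
  rewrite (_ : to_setT (set_val (e (to_setT x))) = e (to_setT x)) ?ed //.
  exact: val_inj.
rewrite (_ : to_setT (set_val (d (to_setT x))) = d (to_setT x)) ?de //.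
exact: val_inj.
Qed.

End Small.

Theorem theorem8p10 (kappa : Type) (C : set linOrd)
  (kappa_infinite : infinite_set [set: kappa])
  (C_scattered : C `<=` Scat kappa)
  (C_nonempty : C !=set0)
  (C_closed : downward_closed kappa C)
  (C_trans : forall L1 L2 L3 : LO kappa,
     piecewise_convex_embeds_LO C L1 L2 -> piecewise_convex_embeds_LO C L2 L3 ->
     piecewise_convex_embeds_LO C L1 L3) :
  forall L0 : LO kappa,
    qo_embeds (piecewise_convex_embeds_LO (kappa := kappa) C)
      (fun L L' : {L : LO kappa | upper_cone C L0 L} =>
         piecewise_convex_embeds_LO C (proj1_sig L) (proj1_sig L')).
Proof.
move=> L0.
have C_Lin : C `<=` Lin kappa by move=> K /C_scattered[].
have [s sI] := infinite_seq kappa_infinite; pose k0 := s 0.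
pose L0rev := sumOrd L0 (revOrd L0).
have [X [u [X_wo u_lt X_copy [i iI]]]] := exists_well_ordered_without_copies L0rev.
have X_L0 (h : X -> L0) : ~ convex_copy h.
  move=> [hE hC]; apply: (X_copy (inl \o h)); split=> // x z [y|y] //= xy yz.
  by have [w <-] := hC _ _ _ xy yz; exists w.
have X_revL0 (h : X -> revOrd L0) : ~ convex_copy h.
  move=> [hE hC]; apply: (X_copy (inr \o h)); split=> // x z [y|y] //= xy yz.
  by have [w <-] := hC _ _ _ xy yz; exists w.
pose M := sandwich X L0 (revOrd X).
have Mk : [set: M] #<= [set: kappa].
  have kk := card_lexx [set: kappa].
  have Xk : [set: X] #<= [set: kappa].
    have /card_le_trans : [set: X] #<= [set: nat + (L0rev * L0rev + unit)].
      by apply/card_le_setTP; exists i.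
    apply; apply: card_le_infinite_sum => //.
      exact: card_le_infinite_countable.
    apply: card_le_infinite_sum => //; last exact: card_le_infinite_countable.
    by apply: card_le_infinite_prod => //; exact: card_le_infinite_sum.
  have QX : [set: rat * X] #<= [set: kappa].
    by apply: card_le_infinite_prod => //; exact: card_le_infinite_countable.
  by do 2?apply: card_le_infinite_sum.
have [e [d [ed de]]] := infinite_prod_bij kappa_infinite (midpt X (revOrd X) (k0 : L0)) Mk.
pose phi (L : LO kappa) : LO kappa :=
  MkLO (@pull_total_order kappa (prodOrd L M) e (can_inj ed)).
have eE (L : LO kappa) : @embedding (phi L) (prodOrd L M) e by [].
have dE (L : LO kappa) : @embedding (prodOrd L M) (phi L) d.
  by move=> x y; rewrite -(eE L) !de.
have eS y : exists x, e x = y by exists (d y).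
have dS y : exists x, d x = y by exists (e y).
have pceP (L L' : LO kappa) :=
  @piecewise_convex_embedsP kappa C L L' k0 C_Lin C_closed.
have phi_cone (L : LO kappa) : upper_cone C L0 (phi L).
  apply/pceP.
  exists unitOrd, (fun=> tt), (fun p => d (k0, midpt X (revOrd X) p)); split.
    have [K CK] := C_nonempty; apply: (C_closed _ _ _ _ CK).
      split; first by exists tt.
      exact: card_le_infinite_countable.
    have [[k _] _] := C_Lin _ CK; exists (fun=> k) => x y.
    exact: le_refl.
  split=> // [x y|x z y _].
    by rewrite dE; exact: le_prod_same.
  have [[l m] <-] := dS y; rewrite !dE => xp pz.
  have /= El := le_prod_between xp pz; subst l; move: xp pz.
  by rewrite !le_prod_same; case: m => [[//|w]|//] _ _; exists w.
exists (fun L => exist _ (phi L) (phi_cone L)) => L L' /=.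
split=> /pceP[K [c [f [CK cf]]]]; apply/pceP.
- have cf' := indexed_convex_embedding_iso (eE L) eS (dE L') dS
    (indexed_convex_embedding_prod X L0 cf).
  by exists K; do 2!eexists; split; [|exact: cf'].
- have [_ Kscat] := C_scattered _ CK.
  have cf' := indexed_convex_embedding_iso (dE L) dS (eE L') eS cf.
  have cf2 := indexed_convex_embedding_fibres (k0 : L0) X_wo u_lt X_L0 X_revL0
    Kscat cf'.
  by exists K; do 2!eexists; split; [|exact: cf2].
Qed.
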